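(* Assume that $\mathfrak{b}=\omega_1$. Then there is an uncountable subspace of the Sorgenfrey line all of whose finite powers are Hurewicz (in particular, all of its finite powers are Lindelöf).
   Context: The Sorgenfrey line is $\mathbb{R}$ with the topology generated by the intervals $[a,b)$, $a<b$. $[\omega]^\omega$ is the family of infinite subsets of $\omega$; each $x\in[\omega]^\omega$ is identified with the increasing enumeration of its elements, a function in $\omega^\omega$. For $x,y\in[\omega]^\omega$ write $x\le^* y$ if $\{n: x(n)\le y(n)\}$ is cofinite. A set $A\subseteq[\omega]^\omega$ is unbounded if for each $y\in[\omega]^\omega$ there is $x\in A$ with $x\not\le^* y$. The cardinal $\mathfrak{b}$ is the minimal cardinality of an unbounded set in $[\omega]^\omega$. A space $X$ is Hurewicz if for each sequence $\mathcal{U}_0,\mathcal{U}_1,\dots$ of open covers of $X$ there are finite sets $\mathcal{F}_0\subseteq\mathcal{U}_0,\mathcal{F}_1\subseteq\mathcal{U}_1,\dots$ such that for every $x\in X$ the set $\{n\in\omega: x\in\bigcup\mathcal{F}_n\}$ is cofinite. A space is Lindelöf if every open cover has a countable subcover. *)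

(* Defs.v *)
From HB Require Import structures.
From mathcomp Require Import all_boot all_order all_algebra.
From mathcomp Require Import all_classical all_reals.
From mathcomp Require Import topology function_spaces.

Set Implicit Arguments.
Unset Strict Implicit.
Unset Printing Implicit Defensive.

Import Order.TTheory GRing.Theory Num.Theory.
Local Open Scope classical_set_scope.
Local Open Scope card_scope.
Local Open Scope ring_scope.

Definition sorgenfrey (R : realType) : Type := R.

HB.instance Definition _ (R : realType) := Choice.on (sorgenfrey R).

Definition halfopen_intervals (R : realType) : set (set (sorgenfrey R)) :=
  [set I | exists a b : R, a < b /\ I = [set x : R | a <= x < b]].

HB.instance Definition _ (R : realType) :=
  isSubBaseTopological.Build (sorgenfrey R) (@halfopen_intervals R) id.

Definition open_cover (T : topologicalType) (U : set (set T)) :=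
  U `<=` open /\ \bigcup_(V in U) V = [set: T].

Definition hurewicz (T : topologicalType) :=
  forall U : nat -> set (set T), (forall n, open_cover (U n)) ->
  exists F : nat -> set (set T),
    (forall n, F n `<=` U n /\ finite_set (F n)) /\
    (forall x : T, cofinite_set [set n | (\bigcup_(V in F n) V) x]).

Definition lindelof (T : topologicalType) :=
  forall U : set (set T), open_cover U ->
  exists C : set (set T), [/\ C `<=` U, countable C & open_cover C].

Definition inf_subsets : set (set nat) := [set x | infinite_set x].

Definition is_enumeration (x : set nat) (f : nat -> nat) :=
  {homo f : m n / (m < n)%N} /\ range f = x.

(* [get] picks an arbitrary function when [x] is finite; for infinite [x] the
   increasing enumeration exists and is unique, see [enumerationP] and
   [is_enumeration_uniq]. *)
Definition enumeration (x : set nat) : nat -> nat := get (is_enumeration x).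

Lemma is_enumeration_uniq (x : set nat) (f g : nat -> nat) :
  is_enumeration x f -> is_enumeration x g -> f = g.
Proof.
move=> [fi fx] [gi gx].
have mono (h : nat -> nat) : {homo h : m n / (m < n)%N} ->
    forall m n, (h m < h n)%N -> (m < n)%N.
  move=> hi m n; rewrite !ltnNge; apply: contra; rewrite leq_eqVlt.
  by case/predU1P => [->//|/hi/ltnW].
apply/funext => n; elim/ltn_ind: n => n IH.
wlog lt_fg : f g fi fx gi gx IH / (f n < g n)%N.
  move=> H; case: (ltngtP (f n) (g n)) => // lt; first exact: H.
  by apply/esym; apply: H => // m /IH.
have : range g (f n) by rewrite gx -fx; exists n.
case=> m _ gmn; have ltmn : (m < n)%N by apply: (mono g) => //; rewrite gmn.
by have := fi _ _ ltmn; rewrite (IH _ ltmn) gmn ltnn.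
Qed.

Lemma enumerationP (x : set nat) :
  inf_subsets x -> is_enumeration x (enumeration x).
Proof.
move=> xinf; apply: (@getPex _ (is_enumeration x)).
have ex m : exists k, `[< x k >] && (m <= k)%N.
  apply/not_existsP => H; apply: xinf.
  apply: (@sub_finite_set _ _ `I_m); last exact: finite_II.
  move=> k xk /=; rewrite ltnNge; apply/negP => mk.
  by apply: (H k); rewrite mk andbT; apply/asboolP.
pose nxt m := ex_minn (ex m).
have nxtP m : [/\ x (nxt m), (m <= nxt m)%N &
    forall k, x k -> (m <= k)%N -> (nxt m <= k)%N].
  rewrite /nxt; case: ex_minnP => k /andP[/asboolP xk mk] kmin; split => // j xj mj.
  by apply: kmin; rewrite mj andbT; apply/asboolP.
pose f := fix f n := if n is n'.+1 then nxt (f n').+1 else nxt 0%N.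
have fS n : (f n < f n.+1)%N by have [] := nxtP (f n).+1.
exists f; split; first by apply: homo_ltn => //; exact: ltn_trans.
apply/seteqP; split => [_ [[|n] _ <-]|k xk].
- by have [] := nxtP 0%N.
- by have [] := nxtP (f n).+1.
have fk n : (n <= f n)%N.
  by elim: n => // n IH; apply: leq_ltn_trans IH (fS n).
have exn : exists n, (k <= f n)%N by exists k.
exists (ex_minn exn) => //.
case: ex_minnP => -[|n] kf nmin; apply/eqP; rewrite eqn_leq kf andbT.
  by have [_ _] := nxtP 0%N; apply.
have [_ _] := nxtP (f n).+1; apply => //.
by rewrite ltnNge; apply/negP => /nmin; rewrite ltnn.
Qed.

Definition le_star (x y : set nat) :=
  cofinite_set [set n | (enumeration x n <= enumeration y n)%N].

Definition unbounded_family (A : set (set nat)) :=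
  A `<=` inf_subsets /\
  forall y, inf_subsets y -> exists2 x, A x & ~ le_star x y.

(* Cardinals are represented by sets up to [#=]: [K] has cardinality [b]. *)
Definition card_b (T : Type) (K : set T) :=
  (exists2 A, unbounded_family A & A #= K) /\
  (forall A, unbounded_family A -> K #<= A).

(* [W] ordered by the reflexive relation [le] has order type omega_1, the first
   uncountable ordinal: it is an uncountable well-order all of whose proper
   initial segments are countable. *)
Definition order_type_omega1 (W : choiceType) (le : rel W) :=
  [/\ wochoice.well_order le, ~ countable [set: W]
    & forall w, countable [set v | le v w]].

Definition b_eq_omega1 :=
  exists (W : choiceType) (le : rel W),
    order_type_omega1 le /\ card_b [set: W].

(* Main.v *)
Require Import Defs.
From HB Require Import structures.
From mathcomp Require Import all_boot all_order all_algebra.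
From mathcomp Require Import all_classical all_reals.
From mathcomp Require Import topology function_spaces.
From mathcomp Require Import zify lra.

(** From [b = omega_1] one builds, by recursion along [omega_1], an unbounded
    [<=*]-increasing family [B] of increasing functions. Code [f] in [B] by the
    real with 0/1 digits in base 4 supported on [range f], and let [X] consist of
    these codes together with all fractions [c / 4 ^ m]. If [range f] has a gap
    [[m, n)], then the truncation of the code at [m] is a fraction lying slightly
    to the left of the code, so that the code belongs to small Sorgenfrey
    neighbourhoods of the fraction.

    In [X ^ k], the points with fractional coordinates have neighbourhoods in the
    given covers that prescribe a function [y] such that any [k] functions of [B]
    that exceed [y] at the same argument [n] have a common gap, by the pigeonhole
    principle, which puts the [k]-tuple of their codes in finitely many
    neighbourhoods chosen at stage [n]. Some [f0] in [B] exceeds [y] on an infinite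
    set, and then so do, up to finitely many arguments of that same set, all but
    countably many members of [B]. The remaining [k]-tuples have a coordinate in a
    countable set, and are handled by induction on the number of coordinates. *)

Set Implicit Arguments.
Unset Strict Implicit.
Unset Printing Implicit Defensive.

Import Order.TTheory GRing.Theory Num.Theory.

Local Open Scope classical_set_scope.

(** * Neighbourhoods in the Sorgenfrey line and its powers *)

Lemma right_ball_halfopen_intervals (R : realType) (x : sorgenfrey R)
    (s : seq (set (sorgenfrey R))) :
  {in s, forall I, halfopen_intervals I /\ I x} ->
  exists2 e : R, (0 < e)%R & forall y : R,
    ((x : R) <= y < (x : R) + e)%R -> {in s, forall I : set (sorgenfrey R), I y}.
Proof.
elim: s => [_|I s IH sx]; first by exists 1%R.
have [|e e0 He] := IH; first by move=> J sJ; apply: sx; rewrite inE sJ orbT.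
have [[a [b [ab IE]]]] := sx I (mem_head _ _).
rewrite IE /= => /andP[ax xb].
exists (Num.min e (b - x))%R; first by rewrite lt_min e0 subr_gt0.
move=> y /andP[xy yx] K; rewrite inE => /predU1P[->|].
  rewrite /= (le_trans ax xy) /=; apply: lt_le_trans yx _.
  by rewrite -lerBrDl ge_min lexx orbT.
apply: He; rewrite xy; apply: lt_le_trans yx _.
by rewrite lerD2l ge_min lexx.
Qed.

Lemma nbhs_sorgenfrey (R : realType) (x : sorgenfrey R) (A : set (sorgenfrey R)) :
  nbhs x A ->
  exists2 e : R, (0 < e)%R &
    forall y : R, ((x : R) <= y < (x : R) + e)%R -> A y.
Proof.
rewrite nbhsE => -[_ [[D sD <-] [B DB Bx]] sBA].
suff [e e0 He] : exists2 e : R, (0 < e)%R & forall y : R,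
    ((x : R) <= y < (x : R) + e)%R -> B y.
  by exists e => // y /He Hy; apply: sBA; exists B.
have [F sF FB] := sD _ DB; rewrite -{}FB {sBA DB} in Bx *.
have [|e e0 He] := @right_ball_halfopen_intervals R x (finmap.enum_fset F).
  by move=> I FI; split; [apply/set_mem/sF|apply: Bx].
by exists e => // y /He Hy I FI; apply: Hy.
Qed.

(** The sets containing a right-sided box at [p] form a filter. The product topology is a supremum
    of initial topologies, so convergence of this filter to [p] can be checked one coordinate at a
    time. *)
Lemma nbhs_ptws_sorgenfrey (R : realType) (k : nat) (X : set (sorgenfrey R))
    (p : {ptws 'I_k -> X}) (V : set {ptws 'I_k -> X}) :
  nbhs p V ->
  exists2 e : R, (0 < e)%R & forall u : {ptws 'I_k -> X},
    (forall i, (\val (p i) : R) <= \val (u i) < (\val (p i) : R) + e)%R -> V u.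
Proof.
pose F : set_system {ptws 'I_k -> X} := [set A | exists2 e : R, (0 < e)%R &
  forall u : {ptws 'I_k -> X},
    (forall i, (\val (p i) : R) <= \val (u i) < (\val (p i) : R) + e)%R -> A u].
have FF : Filter F.
  split.
  - by exists 1%R.
  - move=> A B [e e0 eA] [d d0 dB]; exists (Num.min e d); first by rewrite lt_min e0.
    by move=> u Hu; split; [apply: eA|apply: dB] => i;
      have /andP[-> /lt_le_trans ->//] := Hu i;
      rewrite lerD2l ge_min lexx ?orbT.
  - by move=> A B AB [e e0 eA]; exists e => // u /eA /AB.
suff : F --> p by apply.
apply/cvg_sup => i A [_ [/= [B [C oC <-] <-]] /= Cp sA].
have [e e0 He] : exists2 e : R, (0 < e)%R & forall y : R,
    ((\val (p i) : R) <= y < (\val (p i) : R) + e)%R -> C y.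
  by apply: nbhs_sorgenfrey; exact: open_nbhs_nbhs.
by exists e => // u Hu; apply: sA; exact: He (Hu i).
Qed.

(** * Eventual domination and the unbounded family *)

Definition increasing (f : nat -> nat) := {homo f : m n / (m < n)%N}.

Definition eventually_le (f g : nat -> nat) :=
  exists N, forall n, (N <= n)%N -> (f n <= g n)%N.

Lemma increasing_geq_id f : increasing f -> forall n, (n <= f n)%N.
Proof. by move=> fi; elim=> // n IH; exact: leq_ltn_trans IH (fi _ _ (ltnSn n)). Qed.

Lemma finite_set_nat_bounded (A : set nat) :
  finite_set A -> exists N, forall n, A n -> (n < N)%N.
Proof.
move=> /finite_fsetP[s ->]; exists (\max_(i <- finmap.enum_fset s) i).+1 => n sn.
by rewrite ltnS; apply: (@leq_bigmax_seq _ _ xpredT id).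
Qed.

Lemma cofinite_set_natP (A : set nat) :
  cofinite_set A <-> exists N, forall n, (N <= n)%N -> A n.
Proof.
split=> [/finite_set_nat_bounded[N AN]|[N AN]].
  by exists N => n Nn; apply: contrapT => /AN; rewrite ltnNge Nn.
apply: (@sub_finite_set _ _ `I_N); last exact: finite_II.
by move=> n /= nA; rewrite ltnNge; apply/negP => /AN.
Qed.

Lemma countable_eventually_bounded (C : set (nat -> nat)) (e : nat -> nat) :
  countable C -> exists h, [/\ increasing h, forall n, (e n <= h n)%N &
    forall g, C g -> eventually_le g h].
Proof.
move=> /countable_injP[c cinj].
pose s j := xget e [set g | C g /\ c g = j].
have sE g : C g -> s (c g) = g.
  move=> Cg; rewrite /s; case: xgetP => [h _ [Ch /cinj->]|/(_ g)]//; rewrite ?inE//.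
  by case.
(* Diagonal sum: [h0 n] contains the term [s j n] for every j <= n, hence bounds [s j] from j on.
   Summing once more makes [h] strictly increasing. *)
pose h0 n := (e n + \sum_(j < n.+1) s j n)%N.
pose h n := (n + \sum_(i < n.+1) h0 i)%N.
have h0h n : (h0 n <= h n)%N by rewrite /h big_ord_recr /=; lia.
exists h; split=> [|n|g Cg].
- apply: homo_ltn; first exact: ltn_trans.
  by move=> n; rewrite /h [in X in (_ < X)%N]big_ord_recr /=; lia.
- by apply: leq_trans (h0h n); exact: leq_addr.
- exists (c g) => n gn; apply: leq_trans (h0h n).
  rewrite /h0 (bigD1 (Ordinal (gn : c g < n.+1)%N)) //= sE //; lia.
Qed.

(** The indexing by omega_1 is forgotten. What remains is that one witness [f] against [y] serves
    for almost all of [B]: all but countably many members exceed [y] on the same infinite set as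
    [f], up to finitely many arguments. *)
Definition scale (B : set (nat -> nat)) :=
  B `<=` increasing /\ forall y, exists f,
    [/\ B f, ~ eventually_le f y & countable [set g | B g /\ ~ eventually_le f g]].

Lemma scale_uncountable B : scale B -> ~ countable B.
Proof.
move=> [_ HB] /(@countable_eventually_bounded _ id)[h [_ _ Bh]].
by have [f [/Bh]] := HB h.
Qed.

Lemma range_increasing_infinite f : increasing f -> inf_subsets (range f).
Proof.
move=> fi /finite_set_nat_bounded[N] /(_ (f N) (imageT f N)).
by rewrite ltnNge increasing_geq_id.
Qed.

Lemma enumeration_range f : increasing f -> enumeration (range f) = f.
Proof.
move=> fi; apply: (@is_enumeration_uniq (range f)) => //.
exact/enumerationP/range_increasing_infinite.
Qed.

Lemma well_order_total (W : choiceType) (le : rel W) :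
  wochoice.well_order le -> total le.
Proof.
move=> wo x y; have [|z [[zxy zmin] _]] := wo (pred2 x y).
  by exists x; rewrite inE eqxx.
have := zmin x; have := zmin y; rewrite !inE !eqxx orbT => /(_ isT) zy /(_ isT) zx.
by move: zxy zx zy; rewrite inE => /orP[]/eqP-> zx zy; rewrite ?zx ?zy ?orbT.
Qed.

Lemma well_order_wf (W : choiceType) (le : rel W) :
  wochoice.well_order le -> well_founded (fun v w => ~~ le w v).
Proof.
move=> wo w; apply: contrapT => nw.
have [|z [[/asboolP nz zmin] _]] :=
  wo [pred v | `[< ~ Acc (fun v w => ~~ le w v) v >]].
  by exists w; apply/asboolP.
apply: nz; constructor => v; apply: contraNP => nv; apply: zmin; exact/asboolP.
Qed.

Lemma b_eq_omega1_scale : b_eq_omega1 -> exists B, scale B.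
Proof.
move=> [W [le [[wo _ cle] [[A [Ainf Aunb]]]]]].
rewrite card_eq_sym => /card_set_bijP[g [_ _ gsurj]] _.
pose lt v w := ~~ le w v.
have wf : well_founded lt := well_order_wf wo.
have clt w : countable [set v | lt v w].
  apply: sub_countable (cle w); apply: subset_card_le => v /= nvw.
  by have := well_order_total wo v w; rewrite (negPf nvw) orbF.
(* Each value is to dominate the enumeration of [g w] and all earlier values; such a function exists
   because initial segments are countable. *)
pose P w (rec : forall v, lt v w -> nat -> nat) (h : nat -> nat) :=
  [/\ increasing h, forall n, (enumeration (g w) n <= h n)%N &
      forall v (vw : lt v w), eventually_le (rec v vw) h].
pose f := Fix wf (fun _ => nat -> nat) (fun w rec => get (P w rec)).
have fP w : P w (fun v _ => f v) (f w).
  rewrite {2}/f Fix_eq; last first.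
    by move=> v r s rs; congr (get (P v _));
      apply: functional_extensionality_dep => x;
      apply/funext => y; exact: rs.
  apply: getPex.
  have [|h [hi eh fh]] := @countable_eventually_bounded (f @` [set v | lt v w])
    (enumeration (g w)); first exact: sub_countable (card_image_le _ _) (clt w).
  by exists h; split=> // v vw; apply: fh; exists v.
exists (range f); split=> [_ [w _ <-]|y]; first by have [] := fP w.
(* [le_star] compares enumerations of sets, so [y] is replaced by an increasing majorant, which
   enumerates its own range. *)
have [y' [y'i yy' _]] := @countable_eventually_bounded set0 y (countable0 _).
have [x Ax nx] := Aunb _ (range_increasing_infinite y'i).
have [w _ gw] := gsurj _ Ax.
exists (f w); split; first by exists w.
  move=> [N fy]; apply: nx; apply/cofinite_set_natP; exists N => n Nn /=.
  rewrite enumeration_range // -gw; have [_ /(_ n) gf _] := fP w.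
  by rewrite (leq_trans gf) // (leq_trans (fy n Nn)).
(* If [f v] does not dominate [f w], then w does not precede v, so v lies in the countable segment
   up to w. *)
apply: (@sub_countable _ _ _ (f @` [set v | le v w])); last first.
  exact: sub_countable (card_image_le _ _) (cle w).
apply: subset_card_le => _ [[v _ <-] nwv]; exists v => //=.
by apply: contrapT => /negP vw; have [_ _ /(_ w vw)] := fP v.
Qed.

(** * Base 4 expansions and gaps *)

Section expansion.
Context (R : realType).
Implicit Types d : nat -> bool.
Local Open Scope ring_scope.

(* Base 4 instead of 2, so that distinct digit sequences have distinct sums. *)
Definition digit_sum d m : R := \sum_(i < m) (d i)%:R * 4 ^- i.

Definition expansion d : R := sup (range (digit_sum d)).

Lemma digit_sumS d m : digit_sum d m.+1 = digit_sum d m + (d m)%:R * 4 ^- m.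
Proof. exact: big_ord_recr. Qed.

Lemma expr4V_gt0 m : 0 < 4 ^- m :> R.
Proof. by rewrite invr_gt0 exprn_gt0. Qed.

Lemma expr4VS m : 4 ^- m.+1 = 4^-1 * 4 ^- m :> R.
Proof. by rewrite exprS invfM. Qed.

Lemma digit_sum_le d m n : (m <= n)%N -> digit_sum d m <= digit_sum d n.
Proof.
move=> /subnKC <-; elim: (n - m)%N => [|k IH]; first by rewrite addn0.
rewrite addnS digit_sumS (le_trans IH) // lerDl mulr_ge0 //.
exact/ltW/expr4V_gt0.
Qed.

(** The digits from place n on contribute at most 4/3 times [4 ^- n]; the cruder factor 2 passes
    through the induction since 1 + 2/4 <= 2. *)
Lemma digit_sum_ub d m n :
  (m <= n)%N -> digit_sum d n + 2 * 4 ^- n <= digit_sum d m + 2 * 4 ^- m.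
Proof.
move=> /subnKC <-; elim: (n - m)%N => [|k IH]; first by rewrite addn0.
apply: le_trans IH; rewrite addnS digit_sumS expr4VS.
by have := expr4V_gt0 (m + k); case: (d _) => /=; lra.
Qed.

Lemma expansion_bounds d m :
  digit_sum d m <= expansion d <= digit_sum d m + 2 * 4 ^- m.
Proof.
have H n : digit_sum d n <= digit_sum d m + 2 * 4 ^- m.
  have /orP[/(digit_sum_le d)|/(digit_sum_ub d)] := leq_total n m.
    by have := expr4V_gt0 m; lra.
  by have := expr4V_gt0 n; lra.
apply/andP; split.
  by apply: ub_le_sup; [exists (digit_sum d m + 2 * 4 ^- m) => _ [n _ <-]|exists m].
by apply: ge_sup; [exists (digit_sum d 0), 0%N|move=> _ [n _ <-]].
Qed.

(** At the first difference m, the digit 1 contributes [4 ^- m], while all digits after the 0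
    contribute at most [2 * 4 ^- m.+1], which is half as much. *)
Lemma expansion_inj : injective expansion.
Proof.
move=> c d cd; apply/funext; apply: contrapT => /existsNP[m0 /eqP m0P].
case: (ex_minnP (ex_intro (fun m => c m != d m) m0 m0P)) => m mP mmin.
wlog cm : c d cd {m0 m0P} mP mmin / c m.
  move=> H; case cm : (c m); first exact: (H c d).
  apply: (H d c) => //; first by rewrite eq_sym.
    by move=> n; rewrite eq_sym; exact: mmin.
  by move: mP; rewrite cm; case: (d m).
have dm : d m = false by move: mP; rewrite cm; case: (d m).
have E : digit_sum c m = digit_sum d m.
  apply: eq_bigr => i _; congr (_%:R * _); congr nat_of_bool.
  by apply/eqP; apply: contraTT (ltn_ord i) => /mmin; rewrite leqNgt.
have /andP[+ _] := expansion_bounds c m.+1.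
have /andP[_ +] := expansion_bounds d m.+1.
rewrite cd !digit_sumS E cm dm expr4VS /=.
by have := expr4V_gt0 m; lra.
Qed.

Lemma digit_sum_grid d m :
  exists2 c, (c < 2 * 4 ^ m)%N & digit_sum d m = c%:R / 4 ^+ m.
Proof.
(* The slack of 2 is needed for the induction: the next numerator is at most 4c + 4, and 4c + 6 <=
   4(c + 2). *)
suff [c Hc ->] : exists2 c, (c.+2 <= 2 * 4 ^ m)%N & digit_sum d m = c%:R / 4 ^+ m.
  by exists c => //; exact: ltnW.
elim: m => [|m [c Hc IH]].
  by exists 0%N => //; rewrite /digit_sum big_ord0 mul0r.
exists (4 * c + 4 * d m)%N; first by rewrite expnS; case: (d m); lia.
rewrite digit_sumS IH exprS invfM -mulrDl natrD !natrM -mulrDr.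
by rewrite mulrACA mulfV ?mul1r ?pnatr_eq0.
Qed.

(** The truncations at m and n coincide. Thus the fraction is determined at level m, whereas its
    distance to the sum is controlled by the end n of the gap. *)
Lemma expansion_gap d m n : (m <= n)%N ->
  (forall i, (m <= i < n)%N -> ~~ d i) ->
  digit_sum d m <= expansion d <= digit_sum d m + 2 * 4 ^- n.
Proof.
move=> mn gap; suff <- : digit_sum d n = digit_sum d m by exact: expansion_bounds.
move: gap; rewrite -(subnKC mn); elim: (n - m)%N => [|k IH gap].
  by rewrite addn0.
rewrite addnS digit_sumS IH.
  have /negPf -> : ~~ d (m + k)%N by apply: gap; lia.
  by rewrite mul0r addr0.
by move=> i ?; apply: gap; lia.
Qed.

End expansion.

(** Only the values [f i l] with l < n can lie below [a (k * n).+1] for i in [S]. These are at most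
    k * n values, so they cannot meet all k * n + 1 intervals. *)
Lemma exists_common_gap (k n : nat) (S : {set 'I_k}) (a : nat -> nat)
    (f : 'I_k -> nat -> nat) :
  {homo a : m n / (m < n)%N} -> (forall i, {homo f i : m n / (m < n)%N}) ->
  (forall i, i \in S -> (a (k * n).+1 <= f i n)%N) ->
  exists2 j, (j <= k * n)%N &
    forall i l, i \in S -> ~~ (a j <= f i l < a j.+1)%N.
Proof.
move=> ai fi af; apply: contrapT => noj.
have H (j : 'I_(k * n).+1) : exists x : 'I_k * 'I_n, (a j <= f x.1 x.2 < a j.+1)%N.
  apply: contrapT => nex; apply: noj; exists j; first by have := ltn_ord j.
  move=> i l Si; apply/negP => /andP[al la]; apply: nex.
  have ln : (l < n)%N.
    rewrite ltnNge; apply/negP => nl.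
    have : (f i n <= f i l)%N by apply: (ltnW_homo (fi i)).
    have : (a j.+1 <= a (k * n).+1)%N by apply: (ltnW_homo ai).
    have := af i Si; lia.
  by exists (i, Ordinal ln); rewrite /= al.
have [x xP] := choice H.
have xinj : injective x.
  move=> j j' jj'; apply/val_inj => /=; apply/eqP.
  have := xP j; have := xP j'; rewrite jj'.
  have am u v : (u <= v)%N -> (a u <= a v)%N by apply: (ltnW_homo ai).
  case: (ltngtP j j') => // /am; lia.
have := leq_card x xinj; rewrite card_prod !card_ord; lia.
Qed.

(** * The Hurewicz property relative to a subset *)

(** Covers are replaced by neighbourhood assignments [V n], and finite subfamilies by lists of
    points. Relativizing to [A] allows a space to be treated piece by piece. *)
Definition selects (T : choiceType) (V : nat -> T -> set T) (A : set T) :=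
  exists P : nat -> seq T, forall u, A u ->
    exists N, forall n, (N <= n)%N -> exists2 p, p \in P n & V n p u.

Lemma selects_set0 (T : choiceType) (V : nat -> T -> set T) : selects V set0.
Proof. by exists (fun=> [::]). Qed.

(** Stage n merges the selections for the first n + 1 sets, so a point of [A j] is caught once n
    exceeds both j and its own threshold. *)
Lemma selects_bigcup_nat (T : choiceType) (V : nat -> T -> set T)
    (A : nat -> set T) :
  (forall j, selects V (A j)) -> selects V (\bigcup_j A j).
Proof.
move=> /choice[P HP].
exists (fun n => flatten [seq P j n | j <- iota 0 n.+1]) => u [j _ Aju].
have [N HN] := HP j u Aju; exists (maxn N j) => n.
rewrite geq_max => /andP[Nn jn]; have [p pP Vp] := HN n Nn; exists p => //.
by apply/flatten_mapP; exists j => //; rewrite mem_iota.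
Qed.

Lemma selects_bigcup (T : choiceType) (V : nat -> T -> set T) (I : Type)
    (D : set I) (A : I -> set T) :
  countable D -> (forall i, D i -> selects V (A i)) ->
  selects V (\bigcup_(i in D) A i).
Proof.
move=> /countable_injP[c cinj] HA.
have -> : \bigcup_(i in D) A i =
    \bigcup_j \bigcup_(i in [set i | D i /\ c i = j]) A i.
  apply/seteqP; split=> [u [i Di Au]|u [j _ [i [Di _] Au]]]; last by exists i.
  by exists (c i) => //; exists i.
apply: selects_bigcup_nat => j.
have [[i [Di cij]]|noi] := pselect (exists i, D i /\ c i = j).
  suff -> : \bigcup_(i in [set i | D i /\ c i = j]) A i = A i by exact: HA.
  apply/seteqP; split=> [u [i' [Di' ci'j] Au]|u Au]; last by exists i.
  by rewrite (cinj i i') ?inE // cij.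
suff -> : \bigcup_(i in [set i | D i /\ c i = j]) A i = set0 by exact: selects_set0.
by rewrite -subset0 => u [i ? _]; apply: noi; exists i.
Qed.

Lemma selectsS (T : choiceType) (V : nat -> T -> set T) (A A' : set T) :
  A `<=` A' -> selects V A' -> selects V A.
Proof. by move=> AA' [P HP]; exists P => u /AA'; exact: HP. Qed.

Lemma selectsU (T : choiceType) (V : nat -> T -> set T) (A A' : set T) :
  selects V A -> selects V A' -> selects V (A `|` A').
Proof.
move=> HA HA'; rewrite -bigcup2E; apply: selects_bigcup_nat => -[|[|j]] //=.
exact: selects_set0.
Qed.

Lemma hurewicz_selects (T : topologicalType) :
  (forall V : nat -> T -> set T, (forall n p, nbhs p (V n p)) -> selects V setT) ->
  hurewicz T.
Proof.
move=> HT U Ucov.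
have /choice[V VP] (np : nat * T) : exists W, U np.1 W /\ W np.2.
  have [_ UT] := Ucov np.1.
  by have : [set: T] np.2 by []; rewrite -UT => -[W UW Wp]; exists W.
have [|P HP] := HT (fun n p => V (n, p)).
  move=> n p; have [UV Vp] := VP (n, p).
  by apply: open_nbhs_nbhs; split => //; have [/(_ _ UV)] := Ucov n.
exists (fun n => [set V (n, p) | p in [set` P n]]); split=> [n|u].
  split=> [_ [p _ <-]|]; first by have [] := VP (n, p).
  exact/finite_image/finite_seq.
apply/cofinite_set_natP; have [N HN] := HP u I; exists N => n /HN[p pP Vu].
by exists (V (n, p)) => //; exists p.
Qed.

Lemma hurewicz_lindelof (T : topologicalType) : hurewicz T -> lindelof T.
Proof.
move=> HT U Ucov; have [F [FP Fcov]] := HT (fun=> U) (fun=> Ucov).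
have FU : \bigcup_n F n `<=` U by move=> V [n _]; have [+ _] := FP n; apply.
exists (\bigcup_n F n); split=> //.
  by apply: bigcup_countable => // n _; apply: finite_set_countable; have [] := FP n.
split=> [V /FU|]; first by have [+ _] := Ucov; apply.
apply/seteqP; split=> // u _; have /cofinite_set_natP[N /(_ N (leqnn N))] := Fcov u.
by move=> [V FV Vu]; exists V => //; exists N.
Qed.

(** * The space and its finite powers *)

Section scale_space.
Context (R : realType) (B : set (nat -> nat)) (scaleB : scale B).

Definition code (f : nat -> nat) : R := expansion R (fun i => `[< range f i >]).

Definition grid_value (m c : nat) : R := (c%:R / 4 ^+ m)%R.

Definition scale_space : set (sorgenfrey R) :=
  [set x | exists m c, x = grid_value m c] `|` code @` B.

Lemma code_inj f g : increasing f -> increasing g -> code f = code g -> f = g.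
Proof.
move=> fi gi /expansion_inj fg.
have E : range f = range g.
  apply/funext => i; apply/propext.
  exact: asbool_eq_equiv (congr1 (@^~ i) fg).
by rewrite -(enumeration_range fi) E enumeration_range.
Qed.

Lemma scale_space_uncountable : ~ countable scale_space.
Proof.
move=> cX; apply: (scale_uncountable scaleB).
have /countable_injP[h hinj] := cX; apply/countable_injP; exists (h \o code).
have XB f : f \in B -> code f \in scale_space.
  by rewrite !inE => Bf; right; exists f.
have [Bi _] := scaleB => f g fB gB /= /hinj-/(_ (XB _ fB) (XB _ gB)).
by move: fB gB; rewrite !inE => /Bi fi /Bi gi; exact: code_inj.
Qed.

Lemma grid_value_in (m c : nat) : grid_value m c \in scale_space.
Proof. by rewrite inE; left; exists m, c. Qed.

Definition grid_point (m c : nat) : scale_space :=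
  exist (fun x => x \in scale_space) _ (grid_value_in m c).

Context (k : nat).
Local Notation T := {ptws 'I_k -> scale_space}.

Definition slice (S : {set 'I_k}) (t : T) : set T :=
  [set u | forall i, i \notin S -> u i = t i].

(** The bound on numerators is that of [digit_sum_grid]; it leaves finitely many centers of each
    level [m]. *)
Definition center (S : {set 'I_k}) (t : T) (m : nat)
    (c : {ffun 'I_k -> 'I_(2 * 4 ^ m)}) : T :=
  fun i => if i \in S then grid_point m (c i) else t i.

Definition centers (S : {set 'I_k}) (t : T) (m : nat) : seq T :=
  codom (@center S t m).

Lemma slice_tail_selects (V : nat -> T -> set T) (S : {set 'I_k}) (t : T) :
  (forall n p, nbhs p (V n p)) ->
  exists2 C : set scale_space, countable C &
    selects V (slice S t `&` [set u | forall i, i \in S -> ~ C (u i)]).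
Proof.
move=> HV.
pose box (p : T) e : set T := [set u | forall i,
  (\val (p i) : R) <= \val (u i) <= (\val (p i) : R) + 2 * 4 ^- e]%R.
have box_sub p e e' : (e <= e')%N -> box p e' `<=` box p e.
  move=> ee' u Hu i; have /andP[-> /le_trans->//] := Hu i.
  by rewrite lerD2l ler_pM2l // lef_pV2 ?posrE ?exprn_gt0 // ler_weXn2l // ler1n.
(* The radius works for all stages [j <= n], so centers chosen at a stage of the
   infinite set [J] also serve all earlier stages. *)
have /choice[r rP] (np : nat * T) : exists e, forall j, (j <= np.1)%N ->
    box np.2 e `<=` V j np.2.
  case: np => n p /=.
  suff /choice[e eP] (j : nat) : exists e, box p e `<=` V j p.
    exists (\max_(j < n.+1) e j) => j jn.
    apply: subset_trans (eP j); apply: box_sub.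
    exact: (leq_bigmax (Ordinal (jn : j < n.+1)%N)).
  have [e e0 He] := nbhs_ptws_sorgenfrey (HV j p).
  suff [N HN] : exists N, (2 * 4 ^- N < e :> R)%R.
    exists N => u Hu; apply: He => i; have /andP[-> /le_lt_trans->//] := Hu i.
    by rewrite ltrD2l.
  exists (Num.bound (2 / e)%R); rewrite -ltr_pdivlMr ?invr_gt0 ?exprn_gt0 //.
  rewrite invrK mulrC -ltr_pdivrMr //.
  have /lt_le_trans := @archi_boundP R (2 / e)%R (divr_ge0 (ler0n _ 2) (ltW e0)).
  by apply; rewrite -natrX ler_nat ltnW // ltn_expl.
(* A gap from [m] to [g n m] is long enough for every center of level [m]: the box with exponent
   [g n m] lies in its neighbourhoods for all stages up to n. Iterating [g n] gives the consecutive
   candidate gaps. *)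
pose g n m := maxn m.+1 (\max_(p <- centers S t m) r (n, p)).
pose a n j := iter j (g n) 0.
have ai n : increasing (a n).
  apply: homo_ltn; first exact: ltn_trans.
  by move=> j; rewrite /a iterS /g leq_maxl.
(* A function exceeding [y] at n satisfies the hypothesis of [exists_common_gap] at n. *)
have [y [_ ya _]] := @countable_eventually_bounded set0 (fun n => a n (k * n).+1)
  (countable0 _).
have [f0 [Bf0 nf0y cf0]] := scaleB.2 y.
have /choice[J JP] (n : nat) : exists m, (n <= m)%N /\ (y m < f0 m)%N.
  apply: contrapT => H; apply: nf0y; exists n => m nm; rewrite leqNgt.
  by apply/negP => ?; apply: H; exists m.
(* Besides the fractions, [C] collects the codes of the countably many members of [B] that do not
   dominate [f0]. *)
pose C : set scale_space := [set x | (exists m c, \val x = grid_value m c) \/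
  exists2 h, B h /\ ~ eventually_le f0 h & \val x = code h].
exists C.
  have : countable ([set x : R | exists m c, x = grid_value m c] `|`
      code @` [set h | B h /\ ~ eventually_le f0 h]).
    rewrite -bigcup2E; apply: bigcup_countable => // -[|[|j]] //= _.
      apply: (@sub_countable _ _ _
        ((fun mc => grid_value mc.1 mc.2) @` [set: nat * nat])).
        by apply: subset_card_le => _ [m [c ->]]; exists (m, c).
      exact: sub_countable (card_image_le _ _) _.
    exact: sub_countable (card_image_le _ _) _.
  move=> /countable_injP[i iinj]; apply/countable_injP; exists (i \o \val).
  have sub x : x \in C ->
      (\val x : R) \in [set x : R | exists m c, x = grid_value m c] `|`
      code @` [set h | B h /\ ~ eventually_le f0 h].
    by rewrite !inE => -[?|[h ? ->]]; [left|right; exists h].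
  by move=> x x' /sub xC /sub x'C /iinj-/(_ xC x'C)/val_inj.
exists (fun n => flatten [seq centers S t (a (J n) j) | j <- iota 0 (k * J n).+1]).
move=> u [ut uC].
(* Coordinates outside [S] are frozen at [t]; [id] is a placeholder for them. *)
have /choice[h hP] (i : 'I_k) : exists h, increasing h /\
    (i \in S -> \val (u i) = code h /\ eventually_le f0 h).
  case: (boolP (i \in S)) => [iS|_]; last by exists id; split.
  have := valP (u i); rewrite inE => -[Hg|[h Bh hE]].
    by exfalso; apply: (uC i iS); left.
  exists h; split; first exact: scaleB.1.
  move=> _; split=> //; apply: contrapT => nh; apply: (uC i iS).
  by right; exists h.
have /choice[M MP] (i : 'I_k) : exists M,
    i \in S -> forall n, (M <= n)%N -> (f0 n <= h i n)%N.
  case: (boolP (i \in S)) => [iS|_]; last by exists 0.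
  by have [_ /(_ iS)[_ [M HM]]] := hP i; exists M.
exists (\max_i M i) => n Mn; have [nJ yJ] := JP n.
have [|i|i iS|j jkn gap] := @exists_common_gap k (J n) S (a (J n)) h.
- exact: ai.
- by have [] := hP i.
- rewrite (leq_trans (ya _)) // (leq_trans (ltnW yJ)) // MP // (leq_trans _ nJ) //.
  by rewrite (leq_trans _ Mn) // leq_bigmax.
have /choice[c cP] (i : 'I_k) : exists c : 'I_(2 * 4 ^ (a (J n) j)),
    digit_sum R (fun l => `[< range (h i) l >]) (a (J n) j) =
      grid_value (a (J n) j) c.
  have [c Hc ->] := digit_sum_grid R (fun l => `[< range (h i) l >]) (a (J n) j).
  by exists (Ordinal Hc).
(* The center truncates all codes at the left end of the common gap. *)
pose p := @center S t (a (J n) j) [ffun i => c i].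
have pc : p \in centers S t (a (J n) j) by exact: codom_f.
exists p; first by apply/flatten_mapP; exists j => //; rewrite mem_iota.
apply: (rP (J n, p)) => //=.
apply: (@box_sub _ _ (a (J n) j.+1)).
  rewrite /a iterS {1}/g leq_max; apply/orP; right.
  exact: (@leq_bigmax_seq _ _ xpredT (fun p => r (J n, p))).
move=> i; rewrite /p /center; case: ifPn => iS; last first.
  by rewrite ut // lexx /= lerDl mulr_ge0 // ltW // expr4V_gt0.
rewrite /= ffunE -cP; have [_ /(_ iS)[-> _]] := hP i.
apply: expansion_gap; first exact: ltnW (ai (J n) j j.+1 (ltnSn j)).
move=> l ln; apply/asboolP => -[l' _ hl]; move: ln; rewrite -hl.
exact/negP/gap.
Qed.

(** A tuple missed by [slice_tail_selects] has some coordinate i in [S] with value in the countable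
    set [C]. Freezing that coordinate leaves countably many slices with one free coordinate
    fewer. *)
Lemma slice_selects (V : nat -> T -> set T) (S : {set 'I_k}) (t : T) :
  (forall n p, nbhs p (V n p)) -> selects V (slice S t).
Proof.
move=> HV; have [n] := ubnP #|S|; elim: n => // n IH in S t *.
rewrite ltnS => Sn.
have [C cC HC] := slice_tail_selects S t HV.
pose upd (ix : 'I_k * scale_space) : T := fun j => if j == ix.1 then ix.2 else t j.
apply: (@selectsS _ _ _ ((slice S t `&` [set u | forall i, i \in S -> ~ C (u i)]) `|`
  \bigcup_(ix in [set` S] `*` C) slice (S :\ ix.1) (upd ix))).
  move=> u ut; have [H|] := pselect (forall i, i \in S -> ~ C (u i)); first by left.
  move=> /existsNP[i /not_implyP[iS /contrapT Cui]]; right.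
  exists (i, u i) => //= j; rewrite !inE negb_and negbK /upd /=.
  by case: eqP => [->//|_ /= jS]; exact: ut.
apply: selectsU => //; apply: selects_bigcup.
  by apply: countableX => //; exact: finite_set_countable.
move=> [i x] [/= iS _]; apply: IH.
by apply: leq_trans Sn; rewrite [X in (_ < X)%N](cardsD1 i) iS.
Qed.

Lemma hurewicz_scale_space : hurewicz T.
Proof.
apply: hurewicz_selects => V HV.
have t : T by move=> i; exact: (grid_point 0 0).
by apply: selectsS (slice_selects [set: 'I_k]%SET t HV) => u _ i; rewrite inE.
Qed.

End scale_space.

Unset Implicit Arguments.

Theorem mainTheorem4 (R : realType) (hb : b_eq_omega1) :
  exists X : set (sorgenfrey R),
    ~ countable X /\
    forall n : nat, hurewicz {ptws 'I_n -> X} /\ lindelof {ptws 'I_n -> X}.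
Proof.
have [B scaleB] := b_eq_omega1_scale hb.
exists (@scale_space R B); split; first exact: scale_space_uncountable.
have H n := @hurewicz_scale_space R B scaleB n.
by move=> n; split; [exact: H|exact/hurewicz_lindelof/H].
Qed.
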